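(* Let $C_1,\ldots,C_n$ be sparse Cantor sets in $\mathbb R$ and $C=C_1\times C_2\times\cdots\times C_n\subset \mathbb R^n$. Then the group $\mathfrak{diff}^1_{\mathbb R^n}(C)$ is countable.
   Context: A Cantor set is a (nonempty) compact totally disconnected set without isolated points. A Cantor subset $K$ of an interval of $\mathbb R$ is $\sigma$-sparse if for any $a<b$ in $K$ there is a complementary interval $(\alpha,\beta)\subset (a,b)\cap (\mathbb R\setminus K)$ such that $\beta-\alpha\geq \sigma(b-a)$; it is sparse if it is $\sigma$-sparse for some $\sigma>0$. $\mathrm{Diff}^1(\mathbb R^n,C)$ is the group of $\mathcal C^1$-diffeomorphisms of $\mathbb R^n$ sending $C$ to itself, and $\mathfrak{diff}^1_{\mathbb R^n}(C)$ is the group of transformations of $C$ that arise as restrictions to $C$ of elements of $\mathrm{Diff}^1(\mathbb R^n,C)$. *)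

(* Defs.v *)
(* MathComp-Analysis, over an arbitrary [R : realType]. *)
From HB Require Import structures.
From mathcomp Require Import all_boot all_order all_algebra.
From mathcomp Require Import all_classical all_reals all_analysis.

Set Implicit Arguments.
Unset Strict Implicit.
Unset Printing Implicit Defensive.

Import Order.TTheory GRing.Theory Num.Theory.
Import numFieldNormedType.Exports.

Local Open Scope classical_set_scope.
Local Open Scope ring_scope.

Definition cantor_set (T : topologicalType) (K : set T) : Prop :=
  [/\ K !=set0, compact K, totally_disconnected K & isolated K = set0].

(* A bounded connected component of the complement of [K]; the component
   contains [x], so [alpha < beta] is automatic. *)
Definition complementary_interval (R : realType) (K : set R) (alpha beta : R)
    : Prop :=
  exists2 x, ~ K x & connected_component (~` K) x = `]alpha, beta[%classic.

Definition sigma_sparse (R : realType) (sigma : R) (K : set R) : Prop :=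
  forall a b, K a -> K b -> a < b ->
    exists alpha beta,
      [/\ complementary_interval K alpha beta,
          `]alpha, beta[%classic `<=` `]a, b[%classic `&` ~` K &
          sigma * (b - a) <= beta - alpha].

Definition sparse (R : realType) (K : set R) : Prop :=
  exists2 sigma, 0 < sigma & sigma_sparse sigma K.

Definition prod_set (R : realType) (n : nat) (C : 'I_n -> set R) :
    set 'rV[R]_n :=
  [set x | forall i, C i (x ord0 i)].

(* Continuity of the derivative is expressed in the matrix space, which is the
   space of linear endomorphisms of R^n written in the standard basis. *)
Definition C1_map (R : realType) (n : nat) (f : 'rV[R]_n -> 'rV[R]_n) : Prop :=
  (forall x, differentiable f x) /\ continuous (jacobian f).

Definition C1_diffeomorphism (R : realType) (n : nat)
    (f : 'rV[R]_n -> 'rV[R]_n) : Prop :=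
  C1_map f /\ exists g, [/\ cancel f g, cancel g f & C1_map g].

(* Diff^1(R^n, C): the diffeomorphisms with f(C) = C, not merely f(C) in C. *)
Definition Diff1 (R : realType) (n : nat) (C : set 'rV[R]_n) :
    set ('rV[R]_n -> 'rV[R]_n) :=
  [set f | C1_diffeomorphism f /\ f @` C = C].

(* The underlying set of the group diff^1_{R^n}(C): its elements are maps on
   the subtype of points of [C], so diffeomorphisms agreeing on [C] are
   identified. *)
Definition diff1 (R : realType) (n : nat) (C : set 'rV[R]_n) : set (C -> C) :=
  [set g | exists2 f, Diff1 C f & forall x : C, \val (g x) = f (\val x)].
Arguments diff1 {R n} C _.

(* Main.v *)
Require Import Defs.
From HB Require Import structures.
From mathcomp Require Import all_boot all_order all_algebra.
From mathcomp Require Import all_classical all_reals all_analysis.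
From mathcomp Require Import finmap ring lra.
Import numFieldNormedType.Exports.
Import Order.TTheory GRing.Theory Num.Theory.

(** The group is countable because it is discrete for the C^1 topology, in a
    local and quantitative form.

    The heart is a rigidity statement.  Let [phi] preserve the product [C] and
    be C^1-close to the identity near a point, and suppose that [phi] moves
    some [x] of [C] close to this point by [v <> 0].  As [phi - id] has a small Lipschitz constant,
    the steps of the orbit [x, phi x, phi (phi x), ...] all stay close to [v]
    for [N] iterations.  In the coordinate [i] where [v] is largest, the orbit
    is then a monotone walk inside [C i] whose [N] steps are all comparable to
    [|v|].  Sparseness forbids this: the walk has total length about [N |v|],
    so it must cross a gap of length about [sigma i * N * |v|], which for
    [N >= 4 / sigma i] is longer than any of its steps
    ([sparse_no_regular_walk], [near_identity_fixes]).

    Applied to [phi = f^-1 o g], this says that a diffeomorphism [f] preserving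
    [C] is determined on [C] near [a] by a sufficiently good approximate
    affine model of [f] around [a]: another map preserving [C] with the same
    model agrees with [f] on the part of [C] close to [a].  Such models can be
    taken with rational data ([rigid_code_exists]), and the existence of an
    arbitrarily good one is the strict differentiability of C^1 maps
    ([C1_strict_differentiable]).  By compactness finitely many models
    determine [f] on all of [C] ([rigid_code_cover]), and there are only
    countably many finite lists of rational data. *)

Local Open Scope classical_set_scope.
Local Open Scope ring_scope.

Section Sparse.
Local Set Implicit Arguments.
Local Unset Strict Implicit.
Variable R : realType.

(** * The sup norm on matrices *)

Lemma mx_coord_norm_le m n (A : 'M[R]_(m, n)) i j : `|A i j| <= `|A|.
Proof.
by rewrite [leRHS]/Num.Def.normr/= mx_normrE; exact: (le_bigmax _ _ (i, j)).
Qed.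

Lemma mx_norm_le m n (A : 'M[R]_(m, n)) r :
  0 <= r -> (forall i j, `|A i j| <= r) -> `|A| <= r.
Proof.
move=> r0 Ar; rewrite [leLHS]/Num.Def.normr/= mx_normrE.
by apply: bigmax_le => // -[i j] _; exact: Ar.
Qed.

Lemma row_norm_attained n (u : 'rV[R]_n) : u != 0 -> exists i, `|u| = `|u ord0 i|.
Proof.
move=> u0; have [|[i j] uE] := @mx_norm_neq0 _ _ _ u.
  by rewrite -[mx_norm u]/(`|u|) normr_eq0.
by exists j; rewrite -[LHS]/(mx_norm u) uE /= (ord1 i).
Qed.

Lemma mulmx_norm_le n (u : 'rV[R]_n) (A : 'M[R]_n) : `|u *m A| <= n%:R * `|A| * `|u|.
Proof.
apply: mx_norm_le => [|i j]; first by rewrite !mulr_ge0.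
rewrite mxE (le_trans (ler_norm_sum _ _ _))//.
apply: (@le_trans _ _ (\sum_(k < n) `|A| * `|u|)).
  by apply: ler_sum => k _; rewrite normrM mulrC ler_pM// mx_coord_norm_le.
by rewrite sumr_const card_ord -[leLHS]mulr_natl mulrA.
Qed.

Lemma rational_approx m n (A : 'M[R]_(m, n)) (e : R) : 0 < e ->
  exists Q : 'M[rat]_(m, n), `|map_mx ratr Q - A| <= e.
Proof.
move=> e0.
have Aq i j : {q : rat | `|ratr q - A i j| <= e}.
  apply: cid; have [|q] := @rat_in_itvoo R (A i j - e) (A i j + e); first by lra.
  by rewrite in_itv/= => /andP[? ?]; exists q; rewrite ler_norml; lra.
exists (\matrix_(i, j) sval (Aq i j)); apply: mx_norm_le => [|i j]; first exact: ltW.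
by rewrite !mxE; exact: svalP (Aq i j).
Qed.

(** * Sparse sets and maps close to the identity *)

(** The gap between [y 0] and [y N] given by sparseness has length at least
    [sigma * N * d / 2 >= 2 * d], more than the longest step [3 / 2 * d], so
    the first point of the walk beyond the left end of the gap falls into the
    gap. *)
Lemma sparse_no_regular_walk (sigma d : R) (K : set R) (y : nat -> R) (N : nat) :
    sigma_sparse sigma K -> 0 < d -> 4 <= sigma * N%:R ->
    (forall k, (k <= N)%N -> K (y k)) ->
    (forall k, (k < N)%N -> d / 2 <= y k.+1 - y k <= 3 / 2 * d) ->
  False.
Proof.
move=> spK d0 sN Ky step.
have N0 : 0 < N%:R :> R.
  by rewrite ltr0n lt0n; apply/eqP => N0; move: sN; rewrite N0 mulr0; lra.
have s0 : 0 < sigma by rewrite -(pmulr_lgt0 _ N0); lra.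
have grow k : (k <= N)%N -> k%:R * (d / 2) <= y k - y 0.
  elim: k => [|k IH] kN; first by rewrite mul0r subrr.
  by have := IH (ltnW kN); have /andP[] := step k kN; rewrite -natr1; lra.
have lenN := grow N (leqnn N).
have y0N : y 0 < y N by rewrite -subr_gt0 (lt_le_trans _ lenN)// mulr_gt0//; lra.
have [a [b [_ gapE lenab]]] := spK _ _ (Ky 0 (leq0n N)) (Ky N (leqnn N)) y0N.
have ab : 2 * d <= b - a by nra.
(* Otherwise the smaller of [y 0] and [a + d] would be a point of the gap that
   is not beyond [y 0]. *)
have ya : y 0 <= a.
  rewrite leNgt; apply/negP => ay.
  have [|] := gapE (Num.min (y 0) (a + d)).
    rewrite /= in_itv/= lt_min gt_min; apply/andP; split.
      by apply/andP; split; lra.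
    by apply/orP; right; lra.
  by rewrite /= in_itv/= lt_min ltxx.
have yb : a < y N.
  have [|] := gapE (a + d); first by rewrite /= in_itv/=; lra.
  by rewrite /= in_itv/=; lra.
have exk : exists k, a < y k by exists N.
case: (ex_minnP exk) => -[|k] yk mink; first by lra.
have kN : (k < N)%N by exact: mink.
have yka : y k <= a by rewrite leNgt; apply/negP => /mink; rewrite ltnn.
have /andP[_ stepk] := step k kN.
have [|_] := gapE (y k.+1); first by rewrite /= in_itv/=; lra.
by apply; exact: Ky.
Qed.

(** If [v = phi x - x] were nonzero, the bound [kappa <= 1 / (4 * N)] would keep
    each of the first [N] steps of the orbit of [x] within [|v| / 2] of [v],
    while the bound [delta / (2 * N)] on the displacement keeps the orbit in
    the ball where these estimates are valid.  A coordinate in which [|v|] is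
    attained then contradicts [sparse_no_regular_walk]. *)
Lemma near_identity_fixes n (C : 'I_n -> set R) (sigma : 'I_n -> R) (N : nat)
    (phi : 'rV[R]_n -> 'rV[R]_n) (c : 'rV[R]_n) (delta kappa : R) :
    (0 < N)%N ->
    (forall i, sigma_sparse (sigma i) (C i)) ->
    (forall i, 4 <= sigma i * N%:R) ->
    (forall x, prod_set C x -> prod_set C (phi x)) ->
    0 <= kappa -> kappa * (4 * N%:R) <= 1 ->
    (forall x y, `|x - c| < delta -> `|y - c| < delta ->
      `|phi x - phi y - (x - y)| <= kappa * `|x - y|) ->
    (forall x, `|x - c| < delta -> `|phi x - x| * (2 * N%:R) <= delta) ->
  forall x, prod_set C x -> `|x - c| < delta / 2 -> phi x = x.
Proof.
move=> N0 spC sN phiC k0 kN phiL phid x Cx xc.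
have {}N0 : 0 < N%:R :> R by rewrite ltr0n.
have half k (a b : R) : (k <= N)%N -> 0 <= b -> a * (2 * N%:R) <= k%:R * b -> a <= b / 2.
  rewrite -(ler_nat R) => kleN b0 abk; have kNb := ler_wpM2r b0 kleN.
  by rewrite -subr_ge0 -(pmulr_lge0 _ N0); lra.
pose s k := iter k phi x.
have Cs k : prod_set C (s k) by elim: k => //= k; exact: phiC.
have d0 : 0 < delta by have := normr_ge0 (x - c); lra.
have near k : (k <= N)%N -> `|s k - c| < delta.
  move=> kleN.
  have : `|s k - x| * (2 * N%:R) <= k%:R * delta.
    elim: k kleN => [|k IH] kleN; first by rewrite subrr normr0 !mul0r.
    have {}IH := IH (ltnW kleN).
    have skc : `|s k - c| < delta.
      have -> : s k - c = (s k - x) + (x - c) by rewrite subrKA.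
      apply: (le_lt_trans (ler_normD _ _)).
      have : k.+1%:R <= N%:R :> R by rewrite ler_nat.
      by rewrite -natr1; nra.
    have := phid _ skc; have := ler_normD (phi (s k) - s k) (s k - x).
    by rewrite subrKA -/(s k.+1) -natr1; nra.
  by move=> /(half _ _ _ kleN (ltW d0)); have := ler_normD (s k - x) (x - c); rewrite subrKA; lra.
apply/eqP; rewrite -subr_eq0; apply/negP => /negP v0.
set v := phi x - x in v0.
have nv0 : 0 < `|v| by rewrite normr_gt0.
pose w k := s k.+1 - s k.
have wv k : (k <= N)%N -> `|w k - v| * (2 * N%:R) <= k%:R * `|v|.
  elim: k => [|k IH] kleN; first by rewrite subrr normr0 !mul0r.
  have {}IH := IH (ltnW kleN).
  have := phiL _ _ (near _ kleN) (near _ (ltnW kleN)).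
  rewrite -/(s k.+2) -/(w k) -/(w k.+1) => dw.
  have := ler_normD (w k.+1 - w k) (w k - v).
  have := ler_normD (w k - v) v.
  have wk := half _ _ _ (ltnW kleN) (ltW nv0) IH.
  rewrite subrKA subrK -natr1 => le1 le2.
  have w2 : `|w k| <= 2 * `|v| by lra.
  have : `|w k.+1 - w k| * (2 * N%:R) <= `|v|.
    have := ler_wpM2r (ltW N0) dw; have := ler_wpM2r (normr_ge0 (w k)) kN; lra.
  by nra.
have [i vi] := row_norm_attained v0.
have coord k : (k <= N)%N -> `|w k ord0 i - v ord0 i| <= `|v| / 2.
  move=> kleN; have := half _ _ _ kleN (ltW nv0) (wv _ kleN).
  by have := mx_coord_norm_le (w k - v) ord0 i; rewrite !mxE; lra.
(* A decreasing walk is read backwards. *)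
have [vpos|vneg] := leP 0 (v ord0 i).
  apply: (@sparse_no_regular_walk (sigma i) `|v| (C i) (fun k => s k ord0 i) N) => //.
    by move=> k _; exact: Cs.
  move=> k kN'; have := coord _ (ltnW kN'); rewrite vi (ger0_norm vpos).
  by rewrite ler_norml !mxE => /andP[? ?]; apply/andP; split; lra.
apply: (@sparse_no_regular_walk (sigma i) `|v| (C i) (fun k => s (N - k)%N ord0 i) N) => //.
  by move=> k _; exact: Cs.
move=> k kN'; have := coord (N - k.+1)%N (leq_subr _ _).
rewrite vi (ltr0_norm vneg) /w subnSK//.
by rewrite ler_norml !mxE => /andP[? ?]; apply/andP; split; lra.
Qed.

(** * Strict differentiability of C^1 maps *)

(** Each coordinate of [f x - f y] is, by the mean value theorem along the
    segment, the corresponding coordinate of [(x - y) *m jacobian f z] for a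
    point [z] of the segment, and [jacobian f z] is close to [jacobian f a]. *)
Lemma C1_strict_differentiable n (f : 'rV[R]_n -> 'rV[R]_n) a (eps : R) :
    C1_map f -> 0 < eps ->
  exists2 delta, 0 < delta & forall x y, `|x - a| < delta -> `|y - a| < delta ->
    `|f x - f y - (x - y) *m jacobian f a| <= eps * `|x - y|.
Proof.
move=> [df cJ] e0.
have e1 : 0 < eps / (n%:R + 1) by rewrite divr_gt0// ltr_wpDl.
have /cvgrPdist_le/(_ _ e1) := cJ a.
move=> /nbhs_ballP[delta/= delta0 Jnear].
exists delta => // x y xa ya.
apply: mx_norm_le => [|i j]; first by rewrite mulr_ge0// ltW.
rewrite {i}ord1.
set u := x - y.
pose k (t : R) : R := f (y + t *: u) ord0 j.
have kE t : (fun h : R => h^-1 *: (k (h *: 1 + t) - k t)) =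
    (fun h => h^-1 *: (f (h *: u + (y + t *: u)) ord0 j - f (y + t *: u) ord0 j)).
  apply/funext => h; rewrite /k; congr (_ *: (f _ _ _ - _)).
  by rewrite /GRing.scale/= mulr1 -/(GRing.scale _ _) scalerDl addrCA.
have fder t : derivable f (y + t *: u) u by exact: diff_derivable.
have dk (t : R) : is_derive t (1 : R) k ((u *m jacobian f (y + t *: u)) ord0 j).
  split; first by rewrite /derivable kE; move/derivable_mxP : (fder t) => /(_ ord0 j).
  by rewrite -deriveEjacobian// derive_mx// mxE /derive kE.
have ck : {within `[0, 1], continuous k}.
  apply: continuous_subspaceT => s.
  by apply/differentiable_continuous/derivable1_diffP; case: (dk s).
have [t t01] := MVT_segment ler01 (fun s _ => dk s) ck.
have yu : y + u = x by rewrite addrC subrK.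
rewrite /k scale1r scale0r addr0 yu subr0 mulr1 => fE.
rewrite [leLHS](_ : _ = `|(u *m (jacobian f (y + t *: u) - jacobian f a)) ord0 j|); last first.
  by rewrite mulmxBr [in RHS]mxE -fE !mxE.
rewrite (le_trans (mx_coord_norm_le _ _ _))// (le_trans (mulmx_norm_le _ _))//.
rewrite ler_wpM2r//.
have Jz : `|jacobian f a - jacobian f (y + t *: u)| <= eps / (n%:R + 1).
  apply: Jnear; rewrite mx_norm_ball /ball_/= distrC.
  have -> : y + t *: u - a = t *: (x - a) + (1 - t) *: (y - a).
    by rewrite /u !scalerBr !scalerBl !scale1r opprB; apply/rowP => l; rewrite !mxE; ring.
  move: t01; rewrite in_itv/= => /andP[t0 t1].
  apply: (le_lt_trans (ler_normD _ _)); rewrite !normrZ !ger0_norm ?subr_ge0//.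
  have [->|tn] := eqVneq t 0; first by lra.
  have tpos : 0 < t by rewrite lt0r tn.
  have tx : t * `|x - a| < t * delta by rewrite ltr_pM2l.
  have ty : (1 - t) * `|y - a| <= (1 - t) * delta.
    by rewrite ler_wpM2l ?subr_ge0// ltW.
  by lra.
have n1 : 0 < n%:R + 1 :> R by rewrite ltr_wpDl.
rewrite distrC (le_trans (ler_wpM2l _ Jz))//.
rewrite mulrCA ger_pMr//.
by rewrite ler_pdivrMr// mul1r lerDl.
Qed.

(** * Rational affine models *)

Section Code.
Variable n : nat.
Implicit Types (f g h : 'rV[R]_n -> 'rV[R]_n) (C : set 'rV[R]_n).

(** A code is the rational data of an affine model [value + (x - center) *m
    slope] on the ball of center [center] and radius [radius], together with
    the accuracy [error] of the model. *)
Definition code := ('rV[rat]_n * rat * 'M[rat]_n * 'rV[rat]_n * rat)%type.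

Definition center (q : code) : 'rV[R]_n := map_mx ratr q.1.1.1.1.
Definition radius (q : code) : R := ratr q.1.1.1.2.
Definition slope (q : code) : 'M[R]_n := map_mx ratr q.1.1.2.
Definition value (q : code) : 'rV[R]_n := map_mx ratr q.1.2.
Definition error (q : code) : R := ratr q.2.

(** The error is measured on differences, relatively to their size: two maps
    with the same code differ by a map with small Lipschitz constant, as
    [near_identity_fixes] requires.  The last clause makes them uniformly
    close, at the scale of the radius. *)
Definition codes (q : code) f :=
  (forall x y, `|x - center q| < radius q -> `|y - center q| < radius q ->
    `|f x - f y - (x - y) *m slope q| <= error q * `|x - y|) /\
  `|f (center q) - value q| <= error q * radius q.

Definition rigid C (q : code) f := forall g, (forall x, C x -> C (g x)) ->
  codes q g -> forall x, C x -> `|x - center q| < radius q / 2 -> g x = f x.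

(** If [g] has the same code as [f], the map [phi = h o g] satisfies the
    hypotheses of [near_identity_fixes].  Indeed, modulo an error of order
    [error q], [phi x - phi y - (x - y)], that is
    [h (g x) - h (g y) - (h (f x) - h (f y))], is the image by the linear map
    [S] of [g x - g y - (f x - f y)], which is itself of that order. The last
    hypothesis ensures that maps with code [q] send the ball of the code into
    the ball of center [w] where [h] is close to linear. *)
Lemma rigid_of_inverse (C : 'I_n -> set R) (sigma : 'I_n -> R) (N : nat)
    (q : code) f h (w : 'rV[R]_n) (S : 'M[R]_n) (L M rho : R) :
    (0 < N)%N ->
    (forall i, sigma_sparse (sigma i) (C i)) ->
    (forall i, 4 <= sigma i * N%:R) ->
    cancel f h -> cancel h f -> (forall x, prod_set C x -> prod_set C (h x)) ->
    codes q f ->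
    (forall u v, `|u - w| < rho -> `|v - w| < rho ->
      `|h u - h v - (u - v) *m S| <= error q * `|u - v|) ->
    0 <= L -> (forall u : 'rV[R]_n, `|u *m S| <= L * `|u|) ->
    0 <= M -> (forall u : 'rV[R]_n, `|u *m slope q| <= M * `|u|) ->
    0 < error q -> error q * ((L + M + 1) * (8 * N%:R)) <= 1 ->
    `|value q - w| + (M + 2 * error q) * radius q < rho ->
  rigid (prod_set C) q f.
Proof.
move=> N0 spC sN fK hK hC [fq fv] hS L0 SL M0 AM e0 eN rho_lb g gC [gq gv] x Cx xc.
suff hgx : h (g x) = x by rewrite -[g x]hK hgx.
set e := error q in fq fv gq gv hS e0 eN rho_lb *.
set c := center q in fq fv gq gv xc *.
set d := radius q in fq fv gq gv xc rho_lb *.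
have d0 : 0 < d by have := normr_ge0 (x - c); lra.
have cd : `|c - c| < d by rewrite subrr normr0.
have N1 : 1 <= N%:R :> R by rewrite ler1n.
have e1 : e <= 1.
  rewrite (le_trans _ eN)// ler_peMr ?(ltW e0)//.
  by have := mulr_ge0 (addr_ge0 L0 M0) (ler0n R N); lra.
have lip k : (forall x y, `|x - c| < d -> `|y - c| < d ->
    `|k x - k y - (x - y) *m slope q| <= e * `|x - y|) ->
    forall y z, `|y - c| < d -> `|z - c| < d -> `|k y - k z| <= (M + e) * `|y - z|.
  move=> kq y z yc zc; have := kq _ _ yc zc; have := AM (y - z).
  by have := ler_normD (k y - k z - (y - z) *m slope q) ((y - z) *m slope q); rewrite subrK; lra.
have near_w k : codes q k -> forall y, `|y - c| < d -> `|k y - w| < rho.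
  move=> [kq kv] y yc; have := lip _ kq _ _ yc cd.
  have := ler_normD (k y - k c) (k c - value q).
  have := ler_normD (k y - value q) (value q - w).
  rewrite !subrKA -/e -/c -/d in kv *.
  have : (M + e) * `|y - c| <= (M + e) * d by rewrite ler_wpM2l//; lra.
  by lra.
have fw := near_w _ (conj fq fv).
have gw := near_w _ (conj gq gv).
have fg y z : `|y - c| < d -> `|z - c| < d ->
    `|g y - g z - (f y - f z)| <= 2 * e * `|y - z|.
  move=> yc zc; have := fq _ _ yc zc; have := gq _ _ yc zc.
  set u := (y - z) *m slope q.
  have := ler_normB (g y - g z - u) (f y - f z - u).
  by rewrite opprB addrA subrK; lra.
have fgd y : `|y - c| < d -> `|g y - f y| <= 4 * e * d.
  move=> yc; have := fg _ _ yc cd.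
  have := ler_normD (g y - g c - (f y - f c)) ((g c - value q) - (f c - value q)).
  have := ler_normB (g c - value q) (f c - value q).
  have -> : g y - g c - (f y - f c) + (g c - value q - (f c - value q)) = g y - f y.
    by apply/rowP => i; rewrite !mxE; ring.
  have : e * `|y - c| <= e * d by rewrite ler_wpM2l// ltW.
  by lra.
pose kappa := 2 * e * (L + M + 1).
apply: (near_identity_fixes (C := C) (sigma := sigma) (N := N)
  (phi := h \o g) (c := c) (delta := d) (kappa := kappa)) => //=.
- by move=> y Cy; apply/hC/gC.
- by rewrite mulr_ge0//; lra.
- by rewrite /kappa; lra.
- move=> y z yc zc; rewrite -{2}(fK y) -{2}(fK z).
  have hg := hS _ _ (gw _ yc) (gw _ zc).
  have hf := hS _ _ (fw _ yc) (fw _ zc).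
  have := SL (g y - g z - (f y - f z)); rewrite mulmxBl => le1.
  have := lip _ fq _ _ yc zc; have := lip _ gq _ _ yc zc; have := fg _ _ yc zc.
  set G := (g y - g z) *m S in hg le1; set F := (f y - f z) *m S in hf le1.
  have := ler_normB (h (g y) - h (g z) - G) (h (f y) - h (f z) - F).
  have := ler_normD (h (g y) - h (g z) - G - (h (f y) - h (f z) - F)) (G - F).
  have -> : h (g y) - h (g z) - G - (h (f y) - h (f z) - F) + (G - F) =
            h (g y) - h (g z) - (h (f y) - h (f z)).
    by apply/rowP => i; rewrite !mxE; ring.
  move=> t1 t2 fgyz gyz fyz.
  have r1 := ler_wpM2l L0 fgyz.
  have r2 := ler_wpM2l (ltW e0) gyz.
  have r3 := ler_wpM2l (ltW e0) fyz.
  have r4 : e * (e * `|y - z|) <= e * (1 * `|y - z|) by rewrite (ler_wpM2l (ltW e0))// ler_wpM2r.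
  by rewrite /kappa; lra.
- move=> y yc; rewrite -{2}(fK y).
  have := hS _ _ (gw _ yc) (fw _ yc); have := SL (g y - f y).
  have := ler_normD (h (g y) - h (f y) - (g y - f y) *m S) ((g y - f y) *m S).
  rewrite subrK => t1 t2 t3.
  have t4 : `|h (g y) - h (f y)| <= (L + e) * `|g y - f y| by lra.
  have t5 : (L + e) * `|g y - f y| <= (L + M + 1) * (4 * e * d).
    by apply: ler_pM => //; [lra|lra|exact: fgd].
  have t6 := ler_wpM2r (ltW d0) eN.
  have t7 := ler_wpM2r (ler0n R N) (le_trans t4 t5).
  by lra.
Qed.

(** The parameters are chosen in the following order: the error, from the norms
    of the derivatives of [f] at [a] and of its inverse [h] at [f a]; then
    radii [rho] and [d0] on which [h] and [f] are linear up to this error; then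
    the radius of the code; last, its center, slope and value.  Half of the
    error is spent on the linearization of [f] and half on making the slope
    rational. *)
Lemma rigid_code_exists (C : 'I_n -> set R) (sigma : 'I_n -> R) (N : nat) f a :
    (0 < N)%N ->
    (forall i, sigma_sparse (sigma i) (C i)) ->
    (forall i, 4 <= sigma i * N%:R) ->
    Diff1 (prod_set C) f ->
  exists q, [/\ `|a - center q| < radius q / 2, codes q f & rigid (prod_set C) q f].
Proof.
move=> N0 spC sN [[fC1 [h [fK hK hC1]]] fC].
have hC x : prod_set C x -> prod_set C (h x).
  by rewrite -{1}fC => -[y Cy <-]; rewrite fK.
have NR : 1 <= N%:R :> R by rewrite ler1n.
set w := f a; set T := jacobian f a; set S := jacobian h w.
set L := n%:R * `|S|; set M := n%:R * `|T| + 1.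
have L0 : 0 <= L by rewrite mulr_ge0.
have M1 : 1 <= M by rewrite lerDr mulr_ge0.
have K0 : 0 < (L + M + 1) * (8 * N%:R) by rewrite mulr_gt0//; lra.
have [|er] := @rat_in_itvoo R 0 ((L + M + 1) * (8 * N%:R))^-1; first by rewrite invr_gt0.
rewrite in_itv/= => /andP[e0 /ltW]; set e : R := ratr er in e0 *.
rewrite -[leRHS]div1r ler_pdivlMr// => eK.
have e1 : e <= 1.
  rewrite (le_trans _ eK)// ler_peMr ?(ltW e0)//.
  by have := mulr_ge0 (addr_ge0 L0 (le_trans ler01 M1)) (ler0n R N); lra.
have [rho rho0 hS] := C1_strict_differentiable w hC1 e0.
have e2 : 0 < e / 2 by lra.
have [d0 d0pos fT] := C1_strict_differentiable a fC1 e2.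
have [|dr] := @rat_in_itvoo R 0 (Num.min (d0 / 2) (rho / (2 * (M + 2)))).
  by rewrite lt_min !divr_gt0//; lra.
rewrite in_itv/= lt_min => /and3P[]; set d : R := ratr dr => dpos dd0.
rewrite ltr_pdivlMr; last by lra.
move=> drho.
have [|cr ca] := @rational_approx _ _ a (d / 4); first by lra.
set c : 'rV[R]_n := map_mx ratr cr in ca.
have n1 : 0 < n%:R + 1 :> R by rewrite ltr_wpDl.
have [|Ar AT] := @rational_approx _ _ T (e / 2 / (n%:R + 1)); first by rewrite divr_gt0.
set A : 'M[R]_n := map_mx ratr Ar in AT.
have ed : 0 < e * d by rewrite mulr_gt0.
have [br bc] := rational_approx (f c) ed.
set b : 'rV[R]_n := map_mx ratr br in bc.
have uAT (u : 'rV[R]_n) : `|u *m A - u *m T| <= e / 2 * `|u|.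
  rewrite -mulmxBr (le_trans (mulmx_norm_le _ _))// ler_wpM2r//.
  rewrite (le_trans (ler_wpM2l _ AT))// mulrCA ger_pMr//.
  by rewrite ler_pdivrMr// mul1r lerDl.
have uA (u : 'rV[R]_n) : `|u *m A| <= M * `|u|.
  have := ler_normD (u *m A - u *m T) (u *m T); rewrite subrK.
  have := uAT u; have := mulmx_norm_le u T.
  have := ler_wpM2r (normr_ge0 u) e1; have := normr_ge0 u.
  by rewrite /M; lra.
have near_a x : `|x - c| < d -> `|x - a| < d0.
  by have := ler_normD (x - c) (c - a); rewrite subrKA; lra.
pose q : code := (cr, dr, Ar, br, er).
have fA x y : `|x - c| < d -> `|y - c| < d -> `|f x - f y - (x - y) *m A| <= e * `|x - y|.
  move=> xc yc; have := fT _ _ (near_a _ xc) (near_a _ yc); have := uAT (x - y).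
  have := ler_normB (f x - f y - (x - y) *m T) ((x - y) *m A - (x - y) *m T).
  by rewrite opprB addrA subrK; lra.
have qf : codes q f by split => //; rewrite distrC.
have ac : `|a - c| < d / 2 by rewrite distrC; lra.
exists q; split => //.
apply: (rigid_of_inverse (sigma := sigma) (N := N) (h := h) (w := w) (S := S)
  (L := L) (M := M) (rho := rho)) => //.
- by move=> u; exact: mulmx_norm_le.
- by lra.
- rewrite -[value q]/b -[error q]/e -[radius q]/d.
  have fca : `|f c - w| <= (M + e) * d.
    have := fA c a; rewrite subrr normr0 => /(_ dpos) H.
    have {}H := H (lt_trans ac (ltac:(lra) : d / 2 < d)).
    have := ler_normD (f c - f a - (c - a) *m A) ((c - a) *m A); rewrite subrK.
    have := uA (c - a).
    have : (M + e) * `|c - a| <= (M + e) * d by rewrite ler_wpM2l//; lra.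
    by rewrite -/w; lra.
  have := ler_normD (b - f c) (f c - w); rewrite subrKA.
  have := ler_wpM2r (ltW dpos) e1.
  by lra.
Qed.

Lemma rigid_code_cover (C : 'I_n -> set R) (sigma : 'I_n -> R) (N : nat) f :
    (0 < N)%N ->
    (forall i, compact (C i)) ->
    (forall i, sigma_sparse (sigma i) (C i)) ->
    (forall i, 4 <= sigma i * N%:R) ->
    Diff1 (prod_set C) f ->
  exists s : seq code, {in s, forall q, codes q f} /\
    forall x, prod_set C x -> exists2 q, q \in s &
      `|x - center q| < radius q / 2 /\ rigid (prod_set C) q f.
Proof.
move=> N0 cC spC sN fC.
have := @rV_compact R n C cC; rewrite compact_cover.
move=> /(_ code [set q | codes q f /\ rigid (prod_set C) q f]
  (fun q => ball (center q) (radius q / 2)))[].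
- by move=> q _; exact: ball_open.
- move=> a _; have [q [aq qf rq]] := rigid_code_exists a N0 spC sN fC.
  by exists q => //; rewrite mx_norm_ball /ball_/= distrC.
- move=> D DP cov; exists (enum_fset D); split => [q qD|x Cx].
    by have /DP/set_mem[] := qD.
  have [q qD xq] := cov _ Cx; exists q => //; split.
    by move: xq; rewrite mx_norm_ball /ball_/= distrC.
  by have /DP/set_mem[] := qD.
Qed.

End Code.
End Sparse.

Theorem theorem4 (R : realType) (n : nat) (C : 'I_n -> set R)
    (cantorC : forall i : 'I_n, cantor_set (C i))
    (sparseC : forall i : 'I_n, sparse (C i)) :
  countable (diff1 (prod_set C)).
Proof.
have cC i : compact (C i) by case: (cantorC i).
have /choice[sigma spC] : forall i, exists s : R, (0 < s)%R /\ sigma_sparse s (C i).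
  by move=> i; have [s] := sparseC i; exists s.
pose N := (\sum_i Num.bound (4 / sigma i)%R).+1.
have sN i : (4 <= sigma i * N%:R)%R.
  have s0 := (spC i).1.
  rewrite mulrC -ler_pdivrMr// (le_trans (ltW (archi_boundP _)))//.
    by rewrite divr_ge0// ltW.
  by rewrite ler_nat /N (bigD1 i)//= ltnW// ltnS leq_addr.
pose good (g : prod_set C -> prod_set C) (s : seq (code n)) := exists2 f,
  (forall x : prod_set C, \val (g x) = f (\val x)) &
  {in s, forall q, codes q f} /\
    forall x, prod_set C x -> exists2 q, q \in s &
      (`|x - center R q| < radius R q / 2)%R /\ rigid (prod_set C) q f.
have /choice[F FP] : forall g, exists s, diff1 (prod_set C) g -> good g s.
  move=> g; have [[f fC gf]|] := pselect (diff1 (prod_set C) g); last by exists [::].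
  have [s sP] := rigid_code_cover (ltn0Sn _) cC (fun i => (spC i).2) sN fC.
  by exists s => _; exists f.
apply/countable_injP; exists (choice.pickle \o F) => g1 g2 /set_mem g1P /set_mem g2P /=.
move=> /(pcan_inj choice.pickleK) FE.
have [f1 g1f1 [_ cov1]] := FP _ g1P; have [f2 g2f2 [codes2 _]] := FP _ g2P.
apply/funext => x; apply/val_inj; rewrite g1f1 g2f2.
have Cx : prod_set C (\val x) by exact: set_valP.
(* The rigidity of the code comes from the first map; the second one only has
   to be coded by it. *)
have [q qs [xq rq]] := cov1 _ Cx.
apply/esym/rq => //; last by apply: codes2; rewrite -FE.
move=> y Cy; have := g2f2 (SigSub (mem_set Cy)) => /= <-; exact: set_valP.
Qed.
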